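(* The following hold: $\lambda_\mathbb{R}(2)=\frac{4}{3}$; $\lambda_\mathbb{R}(3)=\frac{1+\sqrt5}{2}$; $\lambda_\mathbb{R}(7)=\frac{5}{2}$; $\lambda_\mathbb{R}(23)=\frac{14}{3}$.
   Context: For a real Banach space $X$ and a finite-dimensional subspace $Y\subset X$, let $\lambda_\mathbb{R}(Y,X)=\inf\{\|P\|\}$ over all bounded linear projections $P$ from $X$ onto $Y$; let $\lambda_\mathbb{R}(Y)=\sup\{\lambda_\mathbb{R}(Y,X):Y\subset X\}$ (over all real Banach spaces $X$ containing $Y$ isometrically); and let $\lambda_\mathbb{R}(m)=\sup\{\lambda_\mathbb{R}(Y):\dim Y=m\}$, the maximal absolute projection constant. *)

(* Defs.v *)
From HB Require Import structures.
From mathcomp Require Import all_boot all_order all_algebra.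
From mathcomp Require Import all_classical all_reals all_analysis.
From mathcomp Require Import Rstruct Rstruct_topology.
From Stdlib Require Import Rdefinitions.
Set Implicit Arguments. Unset Strict Implicit. Unset Printing Implicit Defensive.
Import Order.TTheory GRing.Theory Num.Theory.
Import numFieldNormedType.Exports.
Local Open Scope classical_set_scope.
Local Open Scope ring_scope.

Notation RR := Rdefinitions.R.

Definition is_basis_of (V : normedModType RR) (m : nat) (e : 'I_m -> V)
    (Y : set V) : Prop :=
  (forall c : 'I_m -> RR, \sum_(i < m) c i *: e i = 0 -> forall i, c i = 0) /\
  Y = [set y | exists c : 'I_m -> RR, y = \sum_(i < m) c i *: e i].

(* operator norm of a map, as an extended real (+oo if unbounded) *)
Definition opnorm (V W : normedModType RR) (T : V -> W) : \bar RR :=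
  ereal_inf [set (C%:E)%E | C in
    [set C : RR | 0 <= C /\ forall x, `|T x| <= C * `|x| ]].

Definition is_bounded_projection (X : normedModType RR) (Y : set X)
    (P : X -> X) : Prop :=
  (forall (a : RR) (x y : X), P (a *: x + y) = a *: P x + P y) /\
  (exists C : RR, forall x, `|P x| <= C * `|x|) /\
  (forall x, Y (P x)) /\
  (forall y, Y y -> P y = y).

Definition rel_proj_const (X : normedModType RR) (Y : set X) : \bar RR :=
  ereal_inf [set v | exists P : X -> X,
    is_bounded_projection Y P /\ v = opnorm P].

Definition is_linear_isometry (Y X : normedModType RR) (J : Y -> X) : Prop :=
  (forall (a : RR) (x y : Y), J (a *: x + y) = a *: J x + J y) /\
  (forall y, `|J y| = `|y|).

Definition abs_proj_const (Y : normedModType RR) : \bar RR :=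
  ereal_sup [set v | exists (X : completeNormedModType RR) (J : Y -> X),
    is_linear_isometry J /\ v = rel_proj_const (range J)].

Definition max_abs_proj_const (m : nat) : \bar RR :=
  ereal_sup [set v | exists (Y : normedModType RR) (e : 'I_m -> Y),
    is_basis_of e setT /\ v = abs_proj_const Y].

(* Main.v *)
From Stdlib Require BinInt BinNat RIneq Rbasic_fun.
From Stdlib Require Import BinNums.
Require Import Defs.
From HB Require Import structures.
From mathcomp Require Import all_boot all_order all_algebra.
From mathcomp Require Import all_classical all_reals all_analysis.
From mathcomp Require Import Rstruct Rstruct_topology.
From mathcomp Require Import ring lra.
Import Order.TTheory GRing.Theory Num.Theory.
Import numFieldNormedType.Exports.
Set Implicit Arguments. Unset Strict Implicit. Unset Printing Implicit Defensive.
Local Open Scope classical_set_scope.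
Local Open Scope ring_scope.

(** Put [q = sqrt (m + 2)]; the four values are [(q - 1) (q + 2) / (q + 1)] for
    [m = 2, 3, 7, 23], and this number is an upper bound for every [m >= 2].

    Upper bound. Finitely many functionals of norm one that almost norm [Y] reduce
    the problem to an injective [N x m] matrix [U], for which one wants a left
    inverse [B] such that the rows of [U B] have small [l^1] norm. By a minimax
    argument it is enough to bound a weighted average of these norms, for weights
    [w] chosen by an adversary. Changing the basis so that the rows [u_i] satisfy
    [sum_i w_i u_i u_i^T = 1] and taking [B = U^T diag w], one is left with
    [sum_ij w_i w_j |<u_i, u_j>|]. Writing [u_i = r_i x_i] with [|x_i| = 1], the
    terms [|<x_i, x_j>|] are bounded by an even quartic polynomial, as in the linear
    programming bound for spherical designs; the second moment of the measure
    [w_i r_i] on the sphere is at most [1] and its fourth moment is at least that of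
    the uniform measure.

    Lower bound. If a matrix [S] with entries in [[-1, 1]] satisfies
    [U S = kappa U] for an [m x N] matrix [U] of rank [m], then any projection of
    [l^infty_N] onto the row space of [U] has norm at least [kappa m / N], as one
    sees from the trace of its product with [S]. Suitable [S] are the sign
    matrices of the maximal systems of equiangular lines: [3] lines in the plane,
    the [6] diagonals of the icosahedron, [28] lines in dimension [7], and the
    [276] lines in dimension [23]. *)

(** * The isotropic inequality *)

Lemma cauchy_schwarz_sum (R : realFieldType) (I : finType) (f g : I -> R) :
  (\sum_i f i * g i) ^+ 2 <= (\sum_i f i ^+ 2) * (\sum_i g i ^+ 2).
Proof.
set A := \sum_i f i ^+ 2; set B := \sum_i g i ^+ 2; set C := \sum_i f i * g i.
have B0 : 0 <= B by apply: sumr_ge0 => i _; exact: sqr_ge0.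
have key : \sum_i (B * f i - C * g i) ^+ 2 = B * (A * B - C ^+ 2).
  transitivity (\sum_i (B ^+ 2 * f i ^+ 2 - (2 * B * C) * (f i * g i)
                        + C ^+ 2 * g i ^+ 2)).
    by apply: eq_bigr => i _; ring.
  rewrite big_split /= sumrB -!mulr_sumr -/A -/B -/C; ring.
have : 0 <= B * (A * B - C ^+ 2).
  by rewrite -key; apply: sumr_ge0 => i _; exact: sqr_ge0.
have [B_eq0 _|Bneq0] := eqVneq B 0; last first.
  by rewrite pmulr_rge0 ?subr_ge0 // lt_neqAle eq_sym Bneq0.
suff -> : C = 0 by rewrite B_eq0 mulr0 expr0n.
apply: big1 => i _; move/eqP: B_eq0; rewrite psumr_eq0 => [/allP/(_ i)|j _].
  by rewrite mem_index_enum sqrf_eq0 => /(_ isT)/eqP ->; rewrite mulr0.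
exact: sqr_ge0.
Qed.

Section Dot.
Variables (R : rcfType) (m : nat).
Implicit Types x y : 'I_m -> R.

Definition dot x y : R := \sum_a x a * y a.

Lemma dotC x y : dot x y = dot y x.
Proof. by apply: eq_bigr => a _; rewrite mulrC. Qed.

Lemma dotZl k x y : dot (fun a => k * x a) y = k * dot x y.
Proof. by rewrite /dot mulr_sumr; apply: eq_bigr => a _; rewrite mulrA. Qed.

Lemma dot_ge0 x : 0 <= dot x x.
Proof. by apply: sumr_ge0 => a _; rewrite -expr2 sqr_ge0. Qed.

Lemma dot_cs x y : dot x y ^+ 2 <= dot x x * dot y y.
Proof. exact: cauchy_schwarz_sum. Qed.

Lemma sum_delta (a : 'I_m) (f : 'I_m -> R) :
  \sum_b (a == b)%:R * f b = f a.
Proof.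
rewrite (bigD1 a) //= eqxx mul1r big1 ?addr0 // => b.
by rewrite eq_sym => /negbTE ->; rewrite mul0r.
Qed.

Lemma dot_sqrE x y : dot x y ^+ 2 = \sum_a \sum_b (x a * x b) * (y a * y b).
Proof.
rewrite expr2 {1}/dot mulr_suml; apply: eq_bigr => a _.
by rewrite /dot mulr_sumr; apply: eq_bigr => b _; ring.
Qed.

Local Notation quad := ('I_m * 'I_m * ('I_m * 'I_m))%type.

Let tensor4 x (k : quad) : R := x k.1.1 * x k.1.2 * (x k.2.1 * x k.2.2).

(** The three ways of pairing four indices, summed: up to a factor, the fourth moment tensor of the
    uniform measure on the sphere. *)
Let pairings (k : quad) : R :=
  (k.1.1 == k.1.2)%:R * (k.2.1 == k.2.2)%:R
  + (k.1.1 == k.2.1)%:R * (k.1.2 == k.2.2)%:R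
  + (k.1.1 == k.2.2)%:R * (k.1.2 == k.2.1)%:R.

Let sum_quad (f : quad -> R) :
  \sum_k f k = \sum_a \sum_b \sum_c \sum_d f (a, b, (c, d)).
Proof.
transitivity (\sum_p \sum_q f (p, q)).
  by rewrite pair_bigA; apply: eq_bigr => -[].
transitivity (\sum_a \sum_b \sum_q f ((a, b), q)).
  by rewrite [RHS]pair_bigA; apply: eq_bigr => -[].
apply: eq_bigr => a _; apply: eq_bigr => b _; rewrite pair_bigA.
by apply: eq_bigr => -[].
Qed.

Let dot4E x y : dot x y ^+ 4 = \sum_k tensor4 x k * tensor4 y k.
Proof.
rewrite (_ : 4 = 2 * 2)%N // exprM expr2 dot_sqrE sum_quad mulr_suml.
apply: eq_bigr => a _; rewrite mulr_suml; apply: eq_bigr => b _.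
rewrite mulr_sumr; apply: eq_bigr => c _; rewrite mulr_sumr.
by apply: eq_bigr => d _; rewrite /tensor4 /=; ring.
Qed.

Let sum_pairings (f : quad -> R) : \sum_k pairings k * f k =
  \sum_a \sum_c (f (a, a, (c, c)) + f (a, c, (a, c)) + f (a, c, (c, a))).
Proof.
under eq_bigr do rewrite /pairings !mulrDl -!mulrA.
rewrite 2!big_split /= !sum_quad /=.
under [RHS]eq_bigr do rewrite 2!big_split /=.
rewrite 2!big_split /=; congr (_ + _ + _); apply: eq_bigr => a _.
- under eq_bigr do (under eq_bigr do rewrite -mulr_sumr).
  under eq_bigr do rewrite -mulr_sumr.
  rewrite (sum_delta a (fun b => \sum_c \sum_d (c == d)%:R * f (a, b, (c, d)))).
  apply: eq_bigr => c _.
  by rewrite (sum_delta c (fun d => f (a, a, (c, d)))).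
- apply: eq_bigr => b _.
  under eq_bigr do rewrite -mulr_sumr.
  rewrite (sum_delta a (fun c => \sum_d (b == d)%:R * f (a, b, (c, d)))).
  by rewrite (sum_delta b (fun d => f (a, b, (a, d)))).
- apply: eq_bigr => b _; rewrite exchange_big /=.
  under eq_bigr do rewrite -mulr_sumr.
  rewrite (sum_delta a (fun d => \sum_c (b == c)%:R * f (a, b, (c, d)))).
  by rewrite (sum_delta b (fun c => f (a, b, (c, a)))).
Qed.

Let sum_pairings_tensor4 x :
  \sum_k pairings k * tensor4 x k = 3 * dot x x ^+ 2.
Proof.
rewrite sum_pairings dot_sqrE mulr_sumr; apply: eq_bigr => a _.
by rewrite mulr_sumr; apply: eq_bigr => b _; rewrite /tensor4 /=; ring.
Qed.

(** Each of the three pairings has squared norm [m ^ 2], and each of the six ordered products of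
    distinct pairings sums to [m]. *)
Let sum_pairings_sqr :
  \sum_k pairings k ^+ 2 = 3 * m%:R * (m%:R + 2).
Proof.
under eq_bigr do rewrite expr2.
rewrite sum_pairings /pairings /=.
transitivity (\sum_(a < m) \sum_(c < m) (3 + (a == c)%:R * 6 : R)).
  apply: eq_bigr => a _; apply: eq_bigr => c _.
  by rewrite !eqxx (eq_sym c a); case: eqP => _ /=; ring.
under eq_bigr do rewrite big_split /= (sum_delta _ (fun=> 6)) sumr_const card_ord.
by rewrite sumr_const card_ord; ring.
Qed.

(* The fourth moment tensor of a measure on the sphere has the same pairing with
   the symmetrised identity tensor as that of the uniform measure; Cauchy-Schwarz
   then says that the uniform measure minimises its norm. *)
Lemma fourth_moment_ge (I : finType) (p : I -> R) (x : I -> 'I_m -> R) :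
    (forall i, p i * dot (x i) (x i) = p i) ->
  3 * (\sum_i p i) ^+ 2
    <= m%:R * (m%:R + 2) * \sum_i \sum_j p i * p j * dot (x i) (x j) ^+ 4.
Proof.
move=> px; pose T k := \sum_i p i * tensor4 (x i) k.
have TT : \sum_k T k ^+ 2 = \sum_i \sum_j p i * p j * dot (x i) (x j) ^+ 4.
  transitivity (\sum_k \sum_i \sum_j
      p i * p j * (tensor4 (x i) k * tensor4 (x j) k)).
    apply: eq_bigr => k _; rewrite expr2 {1}/T mulr_suml.
    apply: eq_bigr => i _; rewrite /T mulr_sumr.
    by apply: eq_bigr => j _; ring.
  rewrite exchange_big /=; apply: eq_bigr => i _.
  rewrite exchange_big /=; apply: eq_bigr => j _.
  by rewrite dot4E mulr_sumr.
have TK : \sum_k pairings k * T k = 3 * \sum_i p i.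
  transitivity (\sum_k \sum_i p i * (pairings k * tensor4 (x i) k)).
    by apply: eq_bigr => k _; rewrite mulr_sumr; apply: eq_bigr => i _; ring.
  rewrite exchange_big mulr_sumr /=; apply: eq_bigr => i _.
  by rewrite -mulr_sumr sum_pairings_tensor4 mulrCA; congr (_ * _);
    rewrite expr2 mulrA !px.
have := cauchy_schwarz_sum pairings T.
rewrite TK TT sum_pairings_sqr; set M := \sum_i _; set t := \sum_i _.
by move=> h; rewrite -(ler_pM2l (_ : 0 < 3)) //; lra.
Qed.

End Dot.

Section Isotropic.
Variables (R : rcfType) (m : nat) (I : finType).
Variables (w : I -> R) (u : I -> 'I_m -> R).
Hypothesis w_ge0 : forall i, 0 <= w i.
Hypothesis w_sum : \sum_i w i = 1.
Hypothesis isotropic :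
  forall a b, \sum_i w i * (u i a * u i b) = (a == b)%:R.

Let r i : R := Num.sqrt (dot (u i) (u i)).
(** As [0^-1 = 0], a vanishing row gets [x i = 0]; then [c i i = 0], but [p i = 0] as well. *)
Let x i a : R := (r i)^-1 * u i a.
Let p i : R := w i * r i.
Let c i j : R := dot (x i) (x j).

Let r_ge0 i : 0 <= r i. Proof. exact: sqrtr_ge0. Qed.

Let r2 i : r i ^+ 2 = dot (u i) (u i).
Proof. by rewrite sqr_sqrtr ?dot_ge0. Qed.

Let r0u i a : r i = 0 -> u i a = 0.
Proof.
move=> ri0; have := r2 i; rewrite ri0 expr0n /= => /esym/eqP.
rewrite psumr_eq0 => [/allP/(_ a)|b _]; last by rewrite -expr2 sqr_ge0.
by rewrite mem_index_enum -expr2 sqrf_eq0 => /(_ isT)/eqP.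
Qed.

Let rx i a : r i * x i a = u i a.
Proof.
have [r0|rn0] := eqVneq (r i) 0; first by rewrite r0 mul0r r0u.
by rewrite /x mulrA divff ?mul1r.
Qed.

Let xx i : c i i = (r i != 0)%:R.
Proof.
rewrite /c dotZl dotC dotZl -r2.
have [->|rn0] := eqVneq (r i) 0; first by rewrite invr0 !mul0r.
by rewrite expr2 mulKf // mulVf.
Qed.

Let xx_le1 i : c i i <= 1.
Proof. by rewrite xx lern1 leq_b1. Qed.

Let px i : p i * c i i = p i.
Proof.
rewrite xx /p; have [->|_] := eqVneq (r i) 0; first by rewrite !mulr0.
by rewrite mulr1.
Qed.

Let dot_uu i j : dot (u i) (u j) = r i * r j * c i j.
Proof.
transitivity (dot (fun a => r i * x i a) (fun a => r j * x j a)).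
  by apply: eq_bigr => a _; rewrite !rx.
by rewrite dotZl dotC dotZl dotC mulrA.
Qed.

Let c_le1 i j : `|c i j| <= 1.
Proof.
rewrite -(@ler_pXn2r _ 2) ?nnegrE // expr1n -normrX ger0_norm ?sqr_ge0 //.
apply: le_trans (dot_cs _ _) _; rewrite -[leRHS]mul1r.
by apply: ler_pM; [exact: dot_ge0|exact: dot_ge0|exact: xx_le1|exact: xx_le1].
Qed.

Let p_ge0 i : 0 <= p i. Proof. exact: mulr_ge0. Qed.

Let w_r2 : \sum_i w i * r i ^+ 2 = m%:R.
Proof.
under eq_bigr do rewrite r2 /dot mulr_sumr.
rewrite exchange_big /=; under eq_bigr do rewrite isotropic eqxx.
by rewrite sumr_const card_ord.
Qed.

(** Cauchy-Schwarz against the total weight [1]; the other factor [sum_i w_i r_i ^ 2] is the trace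
    of the identity. *)
Let p_sum_sqr : (\sum_i p i) ^+ 2 <= m%:R.
Proof.
have := cauchy_schwarz_sum (fun i => Num.sqrt (w i)) (fun i => Num.sqrt (w i) * r i).
under eq_bigr do rewrite mulrA -expr2 sqr_sqrtr //.
under [X in _ <= X * _]eq_bigr do rewrite sqr_sqrtr //.
under [X in _ <= _ * X]eq_bigr do rewrite exprMn sqr_sqrtr //.
by rewrite w_sum mul1r w_r2.
Qed.

Let second_moment_le1 : \sum_i \sum_j p i * p j * c i j ^+ 2 <= 1.
Proof.
(* With [S = sum_j p_j x_j x_j^T] the left-hand side is [Q = |S|^2], and expanding
   [sum_i w_i (1 - r_i <x_i, S x_i>)^2 >= 0] gives [0 <= 1 - 2 Q + Q] because
   [<x_i, S x_i>^2 <= |S x_i|^2] and [sum_i w_i |S u_i|^2 = |S|^2]. *)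
pose S a b := \sum_j p j * (x j a * x j b).
pose s i := \sum_j p j * c i j ^+ 2.
set Q := \sum_i _.
have QE : Q = \sum_i w i * (r i * s i).
  apply: eq_bigr => i _; rewrite /s !mulr_sumr.
  by apply: eq_bigr => j _; rewrite /p; ring.
have sE i : s i = dot (x i) (fun a => \sum_b S a b * x i b).
  rewrite /s /dot; under eq_bigr do rewrite dot_sqrE mulr_sumr.
  rewrite exchange_big /=; apply: eq_bigr => a _.
  under eq_bigr do rewrite mulr_sumr.
  rewrite exchange_big mulr_sumr /=; apply: eq_bigr => b _.
  by rewrite /S mulr_suml mulr_sumr; apply: eq_bigr => j _; ring.
have QS : Q = \sum_a \sum_b S a b ^+ 2.
  transitivity (\sum_i \sum_j \sum_a \sum_b
      (p i * (x i a * x i b)) * (p j * (x j a * x j b))).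
    apply: eq_bigr => i _; apply: eq_bigr => j _.
    rewrite dot_sqrE mulr_sumr; apply: eq_bigr => a _; rewrite mulr_sumr.
    by apply: eq_bigr => b _; ring.
  under eq_bigr do rewrite exchange_big /=.
  rewrite exchange_big /=; apply: eq_bigr => a _.
  under eq_bigr do rewrite exchange_big /=.
  rewrite exchange_big /=; apply: eq_bigr => b _.
  rewrite expr2 {1}/S mulr_suml; apply: eq_bigr => i _.
  by rewrite /S mulr_sumr.
have le_s i : (r i * s i) ^+ 2 <= \sum_a (\sum_b S a b * u i b) ^+ 2.
  rewrite exprMn sE; pose y a := \sum_b S a b * x i b.
  have : dot (x i) y ^+ 2 <= dot y y.
    apply: le_trans (dot_cs _ _) _.
    by apply: ler_piMl; [exact: dot_ge0|exact: xx_le1].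
  move=> /(ler_wpM2l (sqr_ge0 (r i))) /le_trans; apply.
  rewrite /dot mulr_sumr le_eqVlt; apply/orP; left; apply/eqP.
  apply: eq_bigr => a _; rewrite -expr2 -exprMn; congr (_ ^+ 2).
  by rewrite mulr_sumr; apply: eq_bigr => b _; rewrite mulrCA rx.
have iso_S : \sum_i w i * (\sum_a (\sum_b S a b * u i b) ^+ 2) = Q.
  rewrite QS; under eq_bigr do rewrite mulr_sumr.
  rewrite exchange_big /=; apply: eq_bigr => a _.
  transitivity (\sum_i \sum_b \sum_d
      (S a b * S a d) * (w i * (u i b * u i d))).
    apply: eq_bigr => i _; rewrite expr2 mulr_suml mulr_sumr.
    apply: eq_bigr => b _; rewrite !mulr_sumr.
    by apply: eq_bigr => d _; ring.
  rewrite exchange_big /=; apply: eq_bigr => b _.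
  rewrite exchange_big /=.
  under eq_bigr do rewrite -mulr_sumr isotropic mulrC.
  by rewrite (sum_delta b (fun d => S a b * S a d)) expr2.
have : 0 <= \sum_i w i * (1 - r i * s i) ^+ 2.
  by apply: sumr_ge0 => i _; apply: mulr_ge0 => //; exact: sqr_ge0.
have : \sum_i w i * (1 - r i * s i) ^+ 2 <= 1 - 2 * Q + Q.
  rewrite -{2}iso_S QE -w_sum !mulr_sumr -sumrB -big_split /=.
  apply: ler_sum => i _.
  have := ler_wpM2l (w_ge0 i) (le_s i).
  by rewrite w_sum; lra.
by move=> h1 h2; have := le_trans h2 h1; lra.
Qed.

Lemma isotropic_abs_dot_le (q : R) : (1 < m)%N -> 0 <= q -> q ^+ 2 = m%:R + 2 ->
  \sum_i \sum_j w i * w j * `|dot (u i) (u j)|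
    <= (q - 1) * (q + 2) / (q + 1).
Proof.
move=> m_gt1 q0 q2.
have mge2 : 2 <= m%:R :> R by rewrite ler_nat.
have q_ge2 : 2 <= q by nra.
set L := \sum_i _.
have LE : L = \sum_i \sum_j p i * p j * `|c i j|.
  apply: eq_bigr => i _; apply: eq_bigr => j _.
  by rewrite dot_uu !normrM !(ger0_norm (r_ge0 _)) /p; ring.
(* [(q s - 1)^2 (1 - s) (q s + q + 2) >= 0] for [s = |c i j|]: the quartic
   majorant of [2 (q+1)^2 s], touching it at [s = 1/q] and at [s = 1]. *)
have pointwise i j : 2 * (q + 1) ^+ 2 * `|c i j| <=
    (q + 2) + q * (q ^+ 2 + 2 * q + 3) * c i j ^+ 2 - q ^+ 3 * c i j ^+ 4.
  have -> : c i j ^+ 4 = `|c i j| ^+ 4.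
    by rewrite (_ : 4 = 2 * 2)%N // !exprM real_normK ?num_real.
  rewrite -(real_normK (num_real (c i j))).
  have := c_le1 i j; have := normr_ge0 (c i j); set s := `|c i j| => s0 s1.
  have : 0 <= (q * s - 1) ^+ 2 * ((1 - s) * (q * s + q + 2)).
    by apply: mulr_ge0; [exact: sqr_ge0|apply: mulr_ge0; nra].
  by nra.
have rho2 := p_sum_sqr; set rho := \sum_i p i in rho2.
have Q1 := second_moment_le1; set Q := \sum_i _ in Q1.
pose F := \sum_i \sum_j p i * p j * c i j ^+ 4.
have F_ge : 3 * rho ^+ 2 <= m%:R * (m%:R + 2) * F by exact: fourth_moment_ge.
have L_le : 2 * (q + 1) ^+ 2 * L <=
    (q + 2) * rho ^+ 2 + q * (q ^+ 2 + 2 * q + 3) * Q - q ^+ 3 * F.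
  have -> : rho ^+ 2 = \sum_i \sum_j p i * p j.
    rewrite expr2 {1}/rho mulr_suml; apply: eq_bigr => i _.
    by rewrite mulr_sumr.
  rewrite LE !mulr_sumr -big_split -sumrB; apply: ler_sum => i _ /=.
  rewrite !mulr_sumr -big_split -sumrB; apply: ler_sum => j _ /=.
  have := ler_wpM2l (mulr_ge0 (p_ge0 i) (p_ge0 j)) (pointwise i j).
  by lra.
have q1 : 0 < q + 1 by lra.
rewrite ler_pdivlMr // -(ler_pM2l (_ : 0 < 2 * (q + 1))); last by lra.
have mE : m%:R = q ^+ 2 - 2 :> R by rewrite q2; ring.
have F2 : 3 * q * rho ^+ 2 <= m%:R * (q ^+ 3 * F).
  have := ler_wpM2l q0 F_ge; rewrite -q2; lra.
have Qb : q * (q ^+ 2 + 2 * q + 3) * Q <= q * (q ^+ 2 + 2 * q + 3).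
  by rewrite ler_piMr //; nra.
(* Once [F] is bounded below, [rho ^ 2] has coefficient [(m (q + 2) - 3 q) / m]; its sign permits
   the use of [rho ^ 2 <= m]. With [m = q ^ 2 - 2] the total is [2 (q + 1) (q - 1) (q + 2)]. *)
have coef : 0 <= m%:R * (q + 2) - 3 * q by rewrite mE; nra.
have := ler_wpM2l coef rho2.
set V := m%:R in mge2 F2 coef rho2 mE * => h.
have V0 : 0 < V by lra.
have : V * ((q + 2) * rho ^+ 2 - q ^+ 3 * F) <= V * (V * (q + 2) - 3 * q) by lra.
rewrite (ler_pM2l V0) mE => h2.
by lra.
Qed.

End Isotropic.

(** * Left inverses with small row sums *)

Definition posdef (R : realFieldType) n (M : 'M[R]_n) :=
  M^T = M /\ forall x : 'rV[R]_n, x != 0 -> 0 < (x *m M *m x^T) 0 0.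

(** Symmetric Gaussian elimination, by induction through the Schur complement [M1] of the top left
    entry. *)
Lemma posdef_diagonalize (R : rcfType) n (M : 'M[R]_n) :
  posdef M -> exists L : 'M[R]_n, L *m M *m L^T = 1%:M.
Proof.
elim: n M => [|n IHn] M [Msym Mpos].
  by exists 0; apply/matrixP => -[].
move: Msym Mpos; rewrite -[n.+1]/(1 + n)%N in M * => Msym Mpos.
pose a : R := M 0 0.
pose v : 'rV[R]_n := ursubmx M.
have ulE : ulsubmx M = a%:M.
  by rewrite [LHS]mx11_scalar !mxE; congr (M _ _)%:M; apply/val_inj.
have dlE : dlsubmx M = v^T by rewrite /v trmx_ursub Msym.
have drT : (drsubmx M)^T = drsubmx M by rewrite trmx_drsub Msym.
have ME : M = block_mx a%:M v v^T (drsubmx M).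
  by rewrite -[LHS]submxK ulE dlE.
have a_gt0 : 0 < a.
  have := Mpos (row_mx 1 0); rewrite {1}ME mul_row_block tr_row_mx mul_row_col.
  rewrite !mul1mx !mul0mx !addr0 trmx1 trmx0 mulmx1 mulmx0 addr0 !mxE eqxx; apply.
  apply/eqP => /(congr1 lsubmx); rewrite row_mxKl linear0 => /matrixP/(_ 0 0).
  by rewrite !mxE => /eqP; rewrite oner_eq0.
have a_neq0 := lt0r_neq0 a_gt0.
pose M1 := drsubmx M - a^-1 *: (v^T *m v).
have [|L LM] := IHn M1.
  split; first by rewrite /M1 linearB linearZ /= trmx_mul trmxK drT.
  (* The first coordinate minimises the form of [M] for given [y]; the minimum is the form of [M1]
     at [y]. *)
  move=> y y0; pose z := row_mx (- a^-1 *: (y *m v^T)) y.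
  have z0 : z != 0.
    apply: contra_neq y0 => /(congr1 rsubmx).
    by rewrite row_mxKr linear0.
  have := Mpos _ z0; rewrite {1}ME /z mul_row_block tr_row_mx mul_row_col.
  rewrite mul_mx_scalar scalerA mulrN divff // scaleN1r addNr mul0mx add0r.
  by rewrite -scalemxAl -mulmxA /M1 mulmxBr -scalemxAr scaleNr addrC.
exists (block_mx (Num.sqrt a)^-1%:M 0 (- a^-1 *: (L *m v^T)) L).
have sa : Num.sqrt a != 0 by rewrite sqrtr_eq0 -ltNge.
have sa2 : Num.sqrt a ^+ 2 = a by rewrite sqr_sqrtr // ltW.
have dl0 : - a^-1 *: (L *m v^T) *m a%:M + L *m v^T = 0.
  by rewrite mul_mx_scalar scalerA mulrN divff // scaleN1r addNr.
have drM : - a^-1 *: (L *m v^T) *m v + L *m drsubmx M = L *m M1.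
  by rewrite /M1 mulmxBr -scalemxAl -mulmxA -scalemxAr scaleNr addrC.
rewrite [in LHS]ME mulmx_block tr_block_mx mulmx_block [RHS](@scalar_mx_block _ 1 n).
rewrite dl0 drM trmx0 !mul0mx !mulmx0 !addr0 !add0r LM tr_scalar_mx.
congr block_mx.
  rewrite -!scalar_mxM; congr (_%:M).
  by rewrite -{2}sa2 expr2 mulKf ?divff.
rewrite -scalar_mxM linearZ /= trmx_mul trmxK !mul_scalar_mx -scalemxAl scalerA.
rewrite -scalerDl mulrN mulfK // addNr scale0r //.
Qed.

(* Let [p_i = max 0 (F i x - phi)]. A step of length [1 / (n + 2)] from [x] towards
   a reply to the weights proportional to [p] takes [sum p_i ^ 2] from
   [Z / (n + 1)] to [Z / (n + 2)]. *)
Lemma approx_minimax (R : archiRealFieldType) (T : lmodType R) (I : finType)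
    (C : T -> Prop) (F : I -> T -> R) (phi K : R) :
    (forall x y t, C x -> C y -> 0 <= t <= 1 ->
       C ((1 - t) *: x + t *: y) /\
       forall i, F i ((1 - t) *: x + t *: y) <= (1 - t) * F i x + t * F i y) ->
    (forall i x, 0 <= F i x) -> 0 <= phi ->
    (exists x, C x /\ forall i, F i x <= K) ->
    (forall w : I -> R, (forall i, 0 <= w i) -> \sum_i w i = 1 ->
       exists x, [/\ C x, \sum_i w i * F i x <= phi & forall i, F i x <= K]) ->
  forall e, 0 < e -> exists x, C x /\ forall i, F i x <= phi + e.
Proof.
move=> convF F0 phi0 exK exw e e0.
pose Z := \sum_(i : I) (K + phi) ^+ 2.
pose p x i := Num.max 0 (F i x - phi).
have Z0 : 0 <= Z by apply: sumr_ge0 => i _; exact: sqr_ge0.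
have le_sqr (a b : R) : a <= b -> Num.max 0 a ^+ 2 <= b ^+ 2.
  by rewrite /Num.max; case: ltP => a0 ab; nra.
have devK x i : F i x <= K -> (F i x - phi) ^+ 2 <= (K + phi) ^+ 2.
  by move=> FK; have := F0 i x; nra.
have step n : exists x, C x /\ \sum_i p x i ^+ 2 <= Z / n.+1%:R.
  elim: n => [|n [x [Cx Dx]]].
    have [x [Cx xK]] := exK; exists x; split=> //.
    rewrite divr1; apply: ler_sum => i _.
    have h1 := devK _ _ (xK i).
    by apply: le_trans h1; exact: le_sqr.
  have p0 i : 0 <= p x i by rewrite /p le_max lexx.
  have [s0|s0] := eqVneq (\sum_i p x i) 0.
    exists x; split=> //; rewrite big1 ?divr_ge0 // => i _.
    move/eqP: s0; rewrite psumr_eq0 // => /allP/(_ i).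
    by rewrite mem_index_enum => /(_ isT)/eqP ->; rewrite expr0n.
  have sgt0 : 0 < \sum_i p x i.
    by rewrite lt_neqAle eq_sym s0; exact: sumr_ge0.
  have [||y [Cy yphi yK]] := exw (fun i => p x i / \sum_i p x i).
  - by move=> i; rewrite divr_ge0 // ltW.
  - by rewrite -mulr_suml divff.
  pose z i := F i y - phi.
  have pz : \sum_i p x i * z i <= 0.
    rewrite /z; under eq_bigr do rewrite mulrBr.
    rewrite sumrB -mulr_suml subr_le0.
    move: yphi; under eq_bigr do rewrite mulrAC.
    by rewrite -mulr_suml ler_pdivrMr // mulrC.
  have zz : \sum_i z i ^+ 2 <= Z by apply: ler_sum => i _; exact: devK.
  (* This [t] minimises [(1 - t) ^ 2 / (n + 1) + t ^ 2], with minimum [1 / (n + 2)]; the cross term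
     is nonpositive by [pz]. *)
  pose t : R := n.+2%:R^-1.
  have n2 : 0 < n.+2%:R :> R by rewrite ltr0n.
  have t0 : 0 < t by rewrite invr_gt0.
  have t1 : t <= 1 by rewrite invf_le1 // ler1n.
  have [|Cxy Fxy] := convF x y t Cx Cy; first by rewrite (ltW t0).
  exists ((1 - t) *: x + t *: y); split=> //.
  apply: (@le_trans _ _ (\sum_i ((1 - t) * p x i + t * z i) ^+ 2)).
    apply: ler_sum => i _; apply: le_sqr.
    have : F i x - phi <= p x i by rewrite /p le_max lexx orbT.
    have := Fxy i; rewrite /z; nra.
  have -> : \sum_i ((1 - t) * p x i + t * z i) ^+ 2 =
     (1 - t) ^+ 2 * (\sum_i p x i ^+ 2) + 2 * t * (1 - t) * (\sum_i p x i * z i)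
     + t ^+ 2 * \sum_i z i ^+ 2.
    rewrite !mulr_sumr -!big_split /=; apply: eq_bigr => i _; ring.
  have E1 : (1 - t) ^+ 2 * (Z / n.+1%:R) + t ^+ 2 * Z = Z / n.+2%:R.
    have nn : n.+1%:R != 0 :> R by rewrite pnatr_eq0.
    have nn2 : n.+2%:R != 0 :> R by rewrite pnatr_eq0.
    move: nn nn2; rewrite /t -(natr1 n.+1).
    by move: (n.+1%:R : R) => k nn nn2; field; rewrite nn nn2.
  rewrite -{}E1.
  have h1 : (1 - t) ^+ 2 * (\sum_i p x i ^+ 2) <= (1 - t) ^+ 2 * (Z / n.+1%:R).
    by rewrite ler_wpM2l // sqr_ge0.
  have h2 : t ^+ 2 * \sum_i z i ^+ 2 <= t ^+ 2 * Z.
    by rewrite ler_wpM2l // sqr_ge0.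
  have h3 : 2 * t * (1 - t) * (\sum_i p x i * z i) <= 0.
    by rewrite mulr_ge0_le0 // mulr_ge0 ?subr_ge0 // mulr_ge0 // ltW.
  by apply: le_trans (lerD (lerD h1 h3) h2) _; rewrite addr0.
have [n Zn] : exists n, Z / n.+1%:R <= e ^+ 2.
  have e2 : 0 < e ^+ 2 by rewrite exprn_gt0.
  exists (Num.bound (Z / e ^+ 2)); rewrite ler_pdivrMr ?ltr0n //.
  rewrite mulrC -ler_pdivrMr //; apply: ltW.
  apply: lt_trans (archi_boundP _) _; first by rewrite divr_ge0 // ltW.
  by rewrite ltr_nat.
have [x [Cx Dx]] := step n; exists x; split=> // i.
have pe : p x i ^+ 2 <= e ^+ 2.
  apply: le_trans Zn; apply: le_trans Dx; rewrite (bigD1 i) //= lerDl.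
  by apply: sumr_ge0 => j _; exact: sqr_ge0.
have : F i x - phi <= p x i by rewrite /p le_max lexx orbT.
have : 0 <= p x i by rewrite /p le_max lexx.
by nra.
Qed.

(** Positive weights and injectivity make [U^T D U] positive definite, so some [V = U L^T] has
    isotropic rows. The entries of [U B] are then [w_j <v_i, v_j>]. *)
Lemma weighted_left_inverse (R : rcfType) N m (U : 'M[R]_(N, m)) (w : 'I_N -> R)
    (q : R) :
    (1 < m)%N -> 0 <= q -> q ^+ 2 = m%:R + 2 ->
    (forall c : 'cV_m, U *m c = 0 -> c = 0) ->
    (forall i, 0 < w i) -> \sum_i w i = 1 ->
  exists B : 'M[R]_(m, N), B *m U = 1%:M /\
    \sum_i w i * (\sum_j `|(U *m B) i j|) <= (q - 1) * (q + 2) / (q + 1).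
Proof.
move=> m1 q0 q2 Uinj w0 w1.
pose D := diag_mx (\row_i w i).
have DE k (A : 'M[R]_(k, N)) i j : (A *m D) i j = A i j * w j.
  by rewrite mul_mx_diag !mxE.
have [|L LM] := @posdef_diagonalize _ _ (U^T *m D *m U).
  split; first by rewrite !trmx_mul trmxK tr_diag_mx mulmxA.
  move=> x x0; pose y := U *m x^T.
  have -> : x *m (U^T *m D *m U) *m x^T = y^T *m D *m y.
    by rewrite /y trmx_mul trmxK !mulmxA.
  rewrite mxE; have yD i : (y^T *m D) 0 i * y i 0 = w i * y i 0 ^+ 2.
    by rewrite DE mxE; ring.
  under eq_bigr do rewrite yD.
  have yw i : 0 <= w i * y i 0 ^+ 2 by rewrite mulr_ge0 ?sqr_ge0 // ltW.
  rewrite lt_neqAle sumr_ge0 // andbT eq_sym; apply: contra_neq x0 => /eqP.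
  rewrite psumr_eq0 // => /allP y0; apply: trmx_inj; rewrite trmx0; apply: Uinj.
  apply/matrixP => i j; rewrite ord1 [RHS]mxE; have := y0 i (mem_index_enum _).
  by rewrite /= mulf_eq0 gt_eqF //= sqrf_eq0 => /eqP.
pose V := U *m L^T.
have VV : V^T *m D *m V = 1%:M.
  by rewrite /V trmx_mul trmxK -LM !mulmxA.
exists (L^T *m (V^T *m D)); split.
  by rewrite -mulmxA; apply: mulmx1C; rewrite -[LHS]mulmxA VV.
have UB i j : (U *m (L^T *m (V^T *m D))) i j = w j * dot (V i) (V j).
  rewrite mulmxA -/V mulmxA DE mulrC mxE; congr (_ * _).
  by apply: eq_bigr => k _; rewrite [V^T _ _]mxE.
apply: le_trans (@isotropic_abs_dot_le _ m _ w V _ w1 _ q m1 q0 q2); last 2 first.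
- by move=> i; rewrite ltW.
- move=> a b; have := congr1 (fun M : 'M[R]_m => M a b) VV; rewrite mxE [RHS]mxE => <-.
  by apply: eq_bigr => i _; rewrite DE [V^T _ _]mxE; ring.
apply: ler_sum => i _; rewrite mulr_sumr; apply: ler_sum => j _.
by rewrite UB normrM ger0_norm ?mulrA // ltW.
Qed.

(** The adversary's weights may vanish, and the minimax argument needs replies with a common bound.
    Mixing in a share [eta] of uniform weights makes every weight at least [eta / N], which settles
    both; the average grows at most from [phi] to [phi' = phi / (1 - eta)]. *)
Lemma left_inverse_row_sums (R : realType) N m (U : 'M[R]_(N, m)) (q : R) :
    (1 < m)%N -> 0 <= q -> q ^+ 2 = m%:R + 2 ->
    (forall c : 'cV_m, U *m c = 0 -> c = 0) ->
  forall e, 0 < e -> exists B : 'M[R]_(m, N), B *m U = 1%:M /\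
    forall i, \sum_j `|(U *m B) i j| <= (q - 1) * (q + 2) / (q + 1) + e.
Proof.
move=> m1 q0 q2 Uinj e e0.
have mge2 : 2 <= m%:R :> R by rewrite ler_nat.
have q_ge2 : 2 <= q by nra.
set phi := _ / _; have phi0 : 0 < phi.
  by rewrite /phi divr_gt0 ?mulr_gt0 ?subr_gt0 ?addr_gt0 //; lra.
have N0 : (0 < N)%N.
  rewrite lt0n; apply/eqP => N0; have := Uinj (const_mx 1).
  have -> : U *m (const_mx 1 : 'cV_m) = 0.
    by apply/matrixP => -[i i_lt]; have := i_lt; rewrite {1}N0.
  move=> /(_ erefl)/matrixP/(_ (Ordinal (ltnW m1)) 0); rewrite !mxE => /eqP.
  by rewrite oner_eq0.
have NR : 0 < N%:R :> R by rewrite ltr0n.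
pose phi' := phi + e / 2.
have phi'0 : 0 < phi' by rewrite addr_gt0 // divr_gt0.
pose eta := (e / 2) / phi'.
have eta0 : 0 < eta by rewrite !divr_gt0.
have etaE : (1 - eta) * phi' = phi.
  by rewrite mulrBl mul1r divfK ?gt_eqF // /phi' addrK.
have eta1 : 0 < 1 - eta by rewrite -(pmulr_lgt0 _ phi'0) etaE.
pose F i (B : 'M[R]_(m, N)) := \sum_j `|(U *m B) i j|.
have F0 i B : 0 <= F i B by apply: sumr_ge0.
have exw (w : 'I_N -> R) : (forall i, 0 <= w i) -> \sum_i w i = 1 ->
  exists B, [/\ B *m U = 1%:M, \sum_i w i * F i B <= phi' &
               forall i, F i B <= phi / (eta / N%:R)].
  move=> w0 w1; pose w' i := (1 - eta) * w i + eta / N%:R.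
  have w'0 i : 0 < w' i by rewrite ltr_wpDl ?divr_gt0 // mulr_ge0 // ltW.
  have [|B [BU Bphi]] := weighted_left_inverse m1 q0 q2 Uinj w'0.
    rewrite big_split /= -mulr_sumr w1 sumr_const card_ord.
    by rewrite -[X in _ + X]mulr_natr divfK ?gt_eqF // mulr1 subrK.
  exists B; split=> // [|i].
    rewrite -(ler_pM2l eta1) etaE; apply: le_trans Bphi.
    rewrite mulr_sumr; apply: ler_sum => i _; rewrite mulrA ler_wpM2r //.
    by rewrite lerDl ltW // divr_gt0.
  rewrite ler_pdivlMr ?divr_gt0 // mulrC; apply: le_trans Bphi.
  rewrite (bigD1 i) //=; apply: ler_wpDr.
    by apply: sumr_ge0 => j _; rewrite mulr_ge0 ?F0 // ltW.
  by rewrite ler_wpM2r // lerDr mulr_ge0 // ltW.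
have [|||B [BU Bphi]] := @approx_minimax R _ 'I_N (fun B => B *m U = 1%:M)
  F phi' (phi / (eta / N%:R)) _ F0 (ltW phi'0) _ exw (e / 2).
- move=> A B t AU BU /andP[t0 t1]; split.
    by rewrite mulmxDl -!scalemxAl AU BU -scalerDl subrK scale1r.
  move=> i; rewrite /F !mulr_sumr -big_split; apply: ler_sum => j _ /=.
  rewrite mulmxDr -!scalemxAr !mxE; apply: le_trans (ler_normD _ _) _.
  by rewrite !normrM (ger0_norm t0) ger0_norm ?subr_ge0.
- have [||B [BU _ BK]] := exw (fun=> N%:R^-1); last by exists B.
    by move=> i; rewrite invr_ge0 ltW.
  by rewrite sumr_const card_ord -[LHS]mulr_natr mulVf ?gt_eqF.
- by rewrite divr_gt0.
by exists B; split=> // i; have := Bphi i; rewrite /phi' /F; lra.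
Qed.

(** * Norming functionals *)

Section HahnBanach.
Variables (R : realType) (X : normedModType R).

(* A linear functional on a subspace is represented by its graph; being dominated
   by the norm makes the relation single-valued. *)
Let lin_graph (A : set (X * R)) :=
  (forall a g h, A g -> A h -> A (a *: g.1 + h.1, a * g.2 + h.2)) /\
  (forall g, A g -> g.2 <= `|g.1|).

Let graph0 A : lin_graph A -> A !=set0 -> A (0, 0).
Proof.
move=> [Alin _] [g Ag]; have := Alin (-1) g g Ag Ag.
by rewrite scaleN1r mulN1r !addNr.
Qed.

(** The one-step extension of Hahn-Banach. By the triangle inequality every [g.2 - |g.1 - x1|] lies
    below every [|h.1 + x1| - h.2]; the supremum of the former serves as value at [x1], and
    rescaling by [1 / |t|] treats all multiples. *)
Let graph_extend A x1 : lin_graph A -> A !=set0 ->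
  exists c, lin_graph [set (g.1 + t *: x1, g.2 + t * c) | g in A & t in [set: R]].
Proof.
move=> LA A0; have [Alin Abnd] := LA.
pose E := [set g.2 - `|g.1 - x1| | g in A].
have A00 := graph0 LA A0.
have Eub h : A h -> ubound E (`|h.1 + x1| - h.2).
  move=> Ah _ [g Ag <-].
  have := Abnd _ (Alin 1 g h Ag Ah); rewrite /= scale1r mul1r => gh.
  have : `|g.1 + h.1| <= `|g.1 - x1| + `|h.1 + x1|.
    rewrite (_ : g.1 + h.1 = (g.1 - x1) + (h.1 + x1)) ?ler_normD //.
    by rewrite addrACA addNr addr0.
  by lra.
have Esup : has_sup E.
  split; first by exists (0 - `|0 - x1|); exists (0, 0).
  by exists (`|0 + x1| - 0); exact: (Eub (0, 0)).
pose c := sup E; exists c; split.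
  move=> a _ _ [g Ag [t _ <-]] [h Ah [s _ <-]] /=.
  exists (a *: g.1 + h.1, a * g.2 + h.2); first exact: Alin.
  exists (a * t + s) => //=; congr pair; last by ring.
  by rewrite scalerDr scalerDl scalerA addrACA.
move=> _ [g Ag [t _ <-]] /=.
have scaled k : A (k *: g.1, k * g.2).
  by have := Alin k g (0, 0) Ag A00; rewrite /= !addr0.
have [t0|t0|->] := ltgtP t 0; last by rewrite scale0r mul0r !addr0 Abnd.
- have : (- t^-1) * g.2 - `|(- t^-1) *: g.1 - x1| <= c.
    apply: ub_le_sup; first by case: Esup.
    by exists ((- t^-1) *: g.1, (- t^-1) * g.2).
  have -> : (- t^-1) *: g.1 - x1 = (- t^-1) *: (g.1 + t *: x1).
    by rewrite scalerDr scalerA mulNr mulVf ?lt_eqF // scaleN1r.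
  rewrite normrZ ger0_norm; last by rewrite oppr_ge0 invr_le0 ltW.
  have t0' : 0 <= - t by rewrite oppr_ge0 ltW.
  move=> /(ler_wpM2l t0'); rewrite mulrBr !mulrA mulrNN divff ?lt_eqF // !mul1r.
  by lra.
- have : c <= `|t^-1 *: g.1 + x1| - t^-1 * g.2.
    apply: ge_sup; first by case: Esup.
    exact: (Eub (t^-1 *: g.1, t^-1 * g.2)).
  have -> : t^-1 *: g.1 + x1 = t^-1 *: (g.1 + t *: x1).
    by rewrite scalerDr scalerA mulVf ?gt_eqF // scale1r.
  rewrite normrZ ger0_norm; last by rewrite invr_ge0 ltW.
  move=> /(ler_wpM2l (ltW t0)); rewrite mulrBr !mulrA divff ?gt_eqF // !mul1r.
  by lra.
Qed.

Lemma norming_functional (x0 : X) : exists f : X -> R,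
  [/\ forall a x y, f (a *: x + y) = a * f x + f y,
      forall x, `|f x| <= `|x| & f x0 = `|x0|].
Proof.
pose g0 : X * R := (x0, `|x0|).
pose P (A : set (X * R)) := lin_graph A /\ (A !=set0 -> A g0).
have [|A [PA Amax]] := @Zorn_bigcup _ P.
- move=> F FP Ftot; split; last first.
    by move=> [g [B FB Bg]]; exists B => //; apply: (FP _ FB).2; exists g.
  split=> [a g h [B FB Bg] [C FC Ch]|g [B FB Bg]]; last exact: (FP _ FB).1.2.
  by have [BC|CB] := Ftot _ _ FB FC;
    [exists C => //; apply: (FP _ FC).1.1 => //; exact: BC
    |exists B => //; apply: (FP _ FB).1.1 => //; exact: CB].
have A0 : A !=set0.
  apply: contrapT => /set0P/negP/negPn/eqP A0.
  apply: (Amax [set (t *: x0, t * `|x0|) | t in [set: R]]).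
    rewrite A0; split=> // /(_ g0); apply.
    by exists 1 => //; rewrite scale1r mul1r.
  split; last by move=> _; exists 1 => //; rewrite scale1r mul1r.
  split=> [a _ _ [t _ <-] [s _ <-]|_ [t _ <-]] /=.
    by exists (a * t + s) => //; rewrite scalerDl scalerA mulrDl mulrA.
  by rewrite normrZ ler_wpM2r // ler_norm.
have [[LA Ag0] [Alin Abnd]] := (PA, PA.1).
have A00 := graph0 LA A0.
have Adom x : exists r, A (x, r).
  apply: contrapT => nAx; have [c LB] := graph_extend x LA A0.
  pose B := [set (g.1 + t *: x, g.2 + t * c) | g in A & t in [set: R]].
  have AB : A `<=` B.
    by move=> [y s] Ag; exists (y, s) => //; exists 0 => //; rewrite scale0r mul0r !addr0.
  apply: (Amax B); last by split=> // _; exact/AB/Ag0.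
  split=> // BA; apply: nAx; exists c; apply: BA.
  by exists (0, 0) => //; exists 1 => //; rewrite scale1r mul1r !add0r.
have [f Af] := choice Adom.
have Auniq x r s : A (x, r) -> A (x, s) -> r = s.
  have Ale r' s' : A (x, r') -> A (x, s') -> s' <= r'.
    move=> Ar As; have := Abnd _ (Alin (-1) _ _ Ar As).
    by rewrite /= scaleN1r addNr normr0; lra.
  by move=> Ar As; apply/eqP; rewrite eq_le !Ale.
exists f; split.
- by move=> a x y; apply: (Auniq (a *: x + y)) => //; exact: (Alin a (x, f x) (y, f y)).
- move=> x; rewrite ler_norml (Abnd (x, f x)) // andbT.
  have := Abnd _ (Alin (-1) _ _ (Af x) A00).
  by rewrite /= !addr0 scaleN1r normrN; lra.
- by apply: (Auniq x0) => //; exact: Ag0.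
Qed.

End HahnBanach.

(** * The upper bound *)

Lemma continuous_lincomb (R : realType) (V : normedModType R) m (e : 'I_m -> V) :
  continuous (fun c : 'rV[R]_m => \sum_k c 0 k *: e k).
Proof.
apply: continuous_big => [|k _ c]; first exact: add_continuous.
apply: (@continuous_comp _ _ _ (fun M : 'rV[R]_m => M 0 k) (fun a : R => a *: e k)).
  exact: coord_continuous.
exact: scalel_continuous.
Qed.

(** A functional norming one vector norms its neighbours up to [1 + eps]. The unit sphere of the
    coefficient space is compact, so finitely many functionals suffice there, and homogeneity does
    the rest. *)
Lemma finite_norming_family (R : realType) (X : normedModType R) m
    (e : 'I_m -> X) (eps : R) :
    (forall c : 'I_m -> R, \sum_k c k *: e k = 0 -> forall k, c k = 0) ->
    0 < eps ->
  exists N (f : 'I_N -> X -> R),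
  [/\ forall j a x y, f j (a *: x + y) = a * f j x + f j y,
      forall j x, `|f j x| <= `|x| &
      forall (c : 'rV[R]_m) (M : R), 0 <= M ->
        (forall j, `|f j (\sum_k c 0 k *: e k)| <= M) ->
        `|\sum_k c 0 k *: e k| <= (1 + eps) * M].
Proof.
move=> free eps0; pose lin (c : 'rV[R]_m) := \sum_k c 0 k *: e k.
have [F FP] := choice (fun c => norming_functional (lin c)).
have Flin c := let: And3 h _ _ := FP c in h.
have Fle c := let: And3 _ h _ := FP c in h.
have Fnorm c := let: And3 _ _ h := FP c in h.
have F0 c : F c 0 = 0.
  by have := Flin c (-1) 0 0; rewrite scaler0 addr0 mulN1r addNr.
have FZ c a x : F c (a *: x) = a * F c x by rewrite -[a *: x]addr0 Flin F0 addr0.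
have FE c d : F c (lin d) = \sum_k d 0 k *: (F c (e k) : R^o).
  rewrite /lin; elim/big_rec2 : _ => [|k x y _ <-]; first exact: F0.
  by rewrite Flin.
have linZ a c : lin (a *: c) = a *: lin c.
  by rewrite /lin scaler_sumr; apply: eq_bigr => k _; rewrite mxE scalerA.
pose K := [set c : 'rV[R]_m | `|c| = 1].
pose O c := [set d : 'rV[R]_m | 0 < (1 + eps) * F c (lin d) - `|lin d|].
have Kcompact : compact K.
  apply: bounded_closed_compact.
    by exists 1; split=> // M M1 c /= ->; exact: ltW.
  apply: (@closed_comp _ _ (fun c : 'rV[R]_m => `|c|) [set x | x = 1]).
    by move=> c _; exact: norm_continuous.
  exact: closed_eq.
have Oopen c : K c -> open (O c).
  have cF : continuous (fun d : 'rV[R]_m => F c (lin d)).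
    rewrite (_ : (fun _ => _) = fun d : 'rV[R]_m => \sum_k d 0 k *: (F c (e k) : R^o)).
      exact: (@continuous_lincomb R R^o).
    by apply/funext => d; exact: FE.
  have cN : continuous (fun d : 'rV[R]_m => `|lin d|).
    move=> d; apply: (@continuous_comp _ _ _ lin Num.norm).
      exact: continuous_lincomb.
    exact: norm_continuous.
  move=> _; apply: (@open_comp 'rV[R]_m R
    (fun d => (1 + eps) * F c (lin d) - `|lin d|) [set x | x > 0]); last exact: open_gt.
  by move=> d _; exact: (cvgB (cvgM (cvg_cst _) (cF d)) (cN d)).
have [D _ KD] : finite_subset_cover K O K.
  move: Kcompact; rewrite compact_cover; apply=> // c Kc; exists c => //.
  rewrite /O /= Fnorm mulrDl mul1r addrAC subrr add0r mulr_gt0 // normr_gt0.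
  apply/eqP => /free c0; move: Kc; rewrite /K /= (_ : c = 0) ?normr0.
    by move/eqP; rewrite eq_sym oner_eq0.
  by apply/rowP => k; rewrite mxE c0.
exists (size (finmap.enum_fset D)), (fun j => F (nth 0 (finmap.enum_fset D) j)).
split=> //.
move=> c M M0 fM; rewrite -/(lin c).
have [->|c0] := eqVneq c 0.
  have -> : lin 0 = 0 by rewrite -(scale0r 0) linZ scale0r.
  by rewrite normr0 mulr_ge0 // addr_ge0 // ltW.
have nc : 0 < `|c| by rewrite normr_gt0.
have [|d dD Od] := KD (`|c|^-1 *: c).
  by rewrite /K /= normrZ normfV normr_id mulVf ?gt_eqF.
have /(nthP 0)[i iD dE] : d \in finmap.enum_fset D by exact: dD.
move: Od; rewrite /O /= linZ FZ normrZ normfV normr_id mulrCA -mulrBr.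
rewrite pmulr_rgt0 ?invr_gt0 // subr_gt0 => /ltW /le_trans; apply.
apply: ler_wpM2l; first by rewrite addr_ge0 // ltW.
by have := fM (Ordinal iD); rewrite /= dE; apply: le_trans; exact: ler_norm.
Qed.

(** The functionals live on all of [X], so [B] turns them into coordinates of a map [P] onto the
    range. [B U = 1] makes [P] fix the range, and the row sums of [U B] bound the functionals on
    [P x]. *)
Lemma rel_proj_const_le (m : nat) (q : RR) (Y X : normedModType RR)
    (e : 'I_m -> Y) (J : Y -> X) :
    (1 < m)%N -> 0 <= q -> q ^+ 2 = m%:R + 2 ->
    is_basis_of e setT -> is_linear_isometry J ->
  (rel_proj_const (range J) <= ((q - 1) * (q + 2) / (q + 1))%:E)%E.
Proof.
move=> m1 q0 q2 [free span] [Jlin Jiso].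
have mge2 : 2 <= m%:R :> RR by rewrite ler_nat.
have q_ge2 : 2 <= q by nra.
set phi := _ / _; have phi0 : 0 < phi.
  by rewrite /phi divr_gt0 ?mulr_gt0 ?subr_gt0 ?addr_gt0 //; lra.
have J0 : J 0 = 0 by apply/normr0_eq0; rewrite Jiso normr0.
have Jsum (c : 'I_m -> RR) : J (\sum_k c k *: e k) = \sum_k c k *: J (e k).
  elim/big_rec2 : _ => [|k x y _ <-]; first exact: J0.
  by rewrite Jlin.
have Jfree (c : 'I_m -> RR) : \sum_k c k *: J (e k) = 0 -> forall k, c k = 0.
  rewrite -Jsum => /(congr1 Num.norm); rewrite Jiso normr0 => /normr0_eq0.
  exact: free.
apply/lee_addgt0Pr => d d0.
(* Chosen so that [(1 + eps) (phi + eps) <= phi + eps (phi + 2) <= phi + d]. *)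
pose eps := Num.min 1 (d / (phi + 2)).
have eps0 : 0 < eps by rewrite lt_min ltr01 divr_gt0 // addr_gt0.
have eps1 : eps <= 1 by rewrite ge_min lexx.
have epsd : eps * (phi + 2) <= d.
  by rewrite -ler_pdivlMr ?addr_gt0 // ge_min lexx orbT.
have [N [f [flin fle fnorm]]] := finite_norming_family Jfree eps0.
have f0 j : f j 0 = 0.
  by have := flin j (-1) 0 0; rewrite scaler0 addr0 mulN1r addNr.
have fsum j (I : finType) (c : I -> RR) (v : I -> X) :
    f j (\sum_k c k *: v k) = \sum_k c k * f j (v k).
  elim/big_rec2 : _ => [|k x y _ <-]; first exact: f0.
  by rewrite flin.
pose U : 'M[RR]_(N, m) := \matrix_(j, k) f j (J (e k)).
have Uinj (c : 'cV[RR]_m) : U *m c = 0 -> c = 0.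
  move=> Uc; have cnorm : `|\sum_k c^T 0 k *: J (e k)| <= (1 + eps) * 0.
    apply: fnorm => // j; rewrite fsum.
    have <- : (U *m c) j 0 = \sum_k c^T 0 k * f j (J (e k)).
      by rewrite mxE; apply: eq_bigr => k _; rewrite !mxE mulrC.
    by rewrite Uc mxE normr0.
  move: cnorm; rewrite mulr0 normr_le0 => /eqP/Jfree c0.
  by apply/matrixP => k l; rewrite ord1 [RHS]mxE -(c0 k) mxE.
have [B [BU Bphi]] := left_inverse_row_sums m1 q0 q2 Uinj eps0.
pose P x := \sum_k (\sum_j B k j * f j x) *: J (e k).
have Ple x : `|P x| <= (phi + d) * `|x|.
  have PE : P x = \sum_k (\row_k \sum_j B k j * f j x) 0 k *: J (e k).
    by apply: eq_bigr => k _; rewrite mxE.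
  apply: (@le_trans _ _ ((1 + eps) * ((phi + eps) * `|x|))); last first.
    by rewrite mulrA ler_wpM2r //; nra.
  rewrite PE; apply: fnorm; first by rewrite mulr_ge0 // addr_ge0 // ltW.
  move=> i; rewrite -PE fsum.
  have -> : \sum_k (\sum_j B k j * f j x) * f i (J (e k)) = \sum_j (U *m B) i j * f j x.
    under eq_bigr do rewrite mulr_suml.
    rewrite exchange_big /=; apply: eq_bigr => j _; rewrite mxE mulr_suml.
    by apply: eq_bigr => k _; rewrite mxE; ring.
  apply: le_trans (ler_norm_sum _ _ _) _.
  apply: (@le_trans _ _ ((\sum_j `|(U *m B) i j|) * `|x|)).
    by rewrite mulr_suml; apply: ler_sum => j _; rewrite normrM ler_wpM2l.
  by rewrite ler_wpM2r.
have PJ y : P (J y) = J y.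
  have [c ->] : exists c : 'I_m -> RR, y = \sum_k c k *: e k.
    by have : [set: Y] y; rewrite // span.
  rewrite Jsum /P.
  apply: eq_bigr => k _; congr (_ *: _).
  under eq_bigr do rewrite fsum mulr_sumr.
  rewrite exchange_big /=.
  have BUk l : \sum_j B k j * (c l * f j (J (e l))) = (k == l)%:R * c l.
    have := congr1 (fun A : 'M[RR]_m => A k l) BU; rewrite mxE [RHS]mxE => <-.
    by rewrite mulr_suml; apply: eq_bigr => j _; rewrite mxE; ring.
  by under eq_bigr do rewrite BUk; rewrite sum_delta.
have Pproj : is_bounded_projection (range J) P.
  split; last split; last split.
  - move=> a x y; rewrite /P scaler_sumr -big_split /=; apply: eq_bigr => k _.
    rewrite scalerA -scalerDl mulr_sumr -big_split /=; congr (_ *: _).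
    by apply: eq_bigr => j _; rewrite flin; ring.
  - by exists (phi + d).
  - by move=> x; exists (\sum_k (\sum_j B k j * f j x) *: e k) => //; rewrite Jsum.
  - by move=> _ [y _ <-]; exact: PJ.
apply: (@le_trans _ _ (opnorm P)).
  by apply: ereal_inf_lbound; exists P.
apply: ereal_inf_lbound; exists (phi + d) => //; split=> //.
by rewrite addr_ge0 // ltW.
Qed.

(** * The lower bound from a sign matrix *)

Lemma rV_norm_coord (R : realType) N (x : 'rV[R]_N) j : `|x 0 j| <= `|x|.
Proof.
rewrite [leRHS]/Num.norm /= mx_normrE.
exact: (le_bigmax _ (fun ij : 'I_1 * 'I_N => `|x ij.1 ij.2|) (0, j)).
Qed.

Lemma rV_norm_le (R : realType) N (x : 'rV[R]_N) (M : R) :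
  0 <= M -> (forall j, `|x 0 j| <= M) -> `|x| <= M.
Proof.
move=> M0 xM; rewrite [leLHS]/Num.norm /= mx_normrE.
by apply: bigmax_le => // -[i j] _; rewrite ord1.
Qed.

HB.instance Definition _ (R : realType) (m n : nat) := Complete.on 'M[R]_(m, n).

(* The row space of [U] in [l^infty_N], carried by the coordinate vectors. *)
Definition row_span N m (U : 'M[RR]_(m, N)) & row_free U : Type := 'rV[RR]_m.

Section RowSpan.
Variables (N m : nat) (U : 'M[RR]_(m, N)) (freeU : row_free U).

HB.instance Definition _ := GRing.Lmodule.on (row_span freeU).

Let norm (y : row_span freeU) : RR := `|(y : 'rV[RR]_m) *m U|.

Let norm_triangle y z : norm (y + z) <= norm y + norm z.
Proof. by rewrite /norm mulmxDl ler_normD. Qed.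

Let normZ (a : RR) y : norm (a *: y) = `|a| * norm y.
Proof. by rewrite /norm -scalemxAl normrZ. Qed.

Let norm0_eq0 y : norm y = 0 -> y = 0.
Proof. by move=> /normr0_eq0/eqP; rewrite mulmx_free_eq0 // => /eqP. Qed.

HB.instance Definition _ :=
  Lmodule_isNormed.Build RR (row_span freeU) norm_triangle normZ norm0_eq0.

Definition row_span_incl (y : row_span freeU) : 'rV[RR]_N := (y : 'rV[RR]_m) *m U.

Lemma row_span_incl_isometry : is_linear_isometry row_span_incl.
Proof. by split=> // a x y; rewrite /row_span_incl mulmxDl -scalemxAl. Qed.

Lemma row_span_basis :
  is_basis_of (fun k : 'I_m => delta_mx 0 k : row_span freeU) setT.
Proof.
split=> [c c0 k|].
  have := row_sum_delta (\row_k c k); under eq_bigr do rewrite mxE.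
  by rewrite [X in _ = X]c0 => /matrixP/(_ 0 k); rewrite !mxE.
apply/seteqP; split=> // y _; exists (fun k => (y : 'rV[RR]_m) 0 k).
exact: row_sum_delta.
Qed.

End RowSpan.

(** A projection has matrix [A = Q U] with [U Q = 1], so [tr (A S) = kappa m]. Conversely [tr (A S)]
    is at most the sum of all [|A i j|]; matrices act on row vectors, so the sign vector of a column
    bounds its sum by [C]. *)
Lemma max_abs_proj_const_ge N m (U : 'M[RR]_(m, N)) (S : 'M[RR]_N) (kappa : RR) :
    (0 < N)%N -> row_free U -> (forall i j, `|S i j| <= 1) ->
    U *m S = kappa *: U ->
  ((kappa * m%:R / N%:R)%:E <= max_abs_proj_const m)%E.
Proof.
move=> N0 freeU S1 US.
pose J := @row_span_incl N m U freeU.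
apply: (@le_trans _ _ (abs_proj_const (row_span freeU))); last first.
  apply: ereal_sup_ubound; exists (row_span freeU), (fun k => delta_mx 0 k).
  by split=> //; exact: row_span_basis.
apply: (@le_trans _ _ (rel_proj_const (range J))); last first.
  apply: ereal_sup_ubound; exists 'rV[RR]_N, J.
  by split=> //; exact: row_span_incl_isometry.
apply/ereal_infP => _ [P [[Plin [_ [Prange Pfix]]] ->]].
apply/ereal_infP => _ [C [C0 PC] <-]; rewrite lee_fin.
have P0 : P 0 = 0 by have := Plin (-1) 0 0; rewrite scaler0 addr0 scaleN1r addNr.
pose A : 'M[RR]_N := \matrix_i P (delta_mx 0 i).
have PA x : P x = x *m A.
  rewrite {1}(row_sum_delta x) mulmx_sum_row.
  elim/big_rec2 : _ => [|i y z _ <-]; first exact: P0.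
  by rewrite Plin rowK.
have [Q QE] : exists Q : 'M[RR]_(N, m), A = Q *m U.
  have /choice[y yE] i : exists y : 'rV[RR]_m, P (delta_mx 0 i) = y *m U.
    by have [y _ <-] := Prange (delta_mx 0 i); exists y.
  by exists (\matrix_i y i); apply/row_matrixP => i; rewrite rowK row_mul rowK yE.
have UA : U *m A = U.
  apply/row_matrixP => k; rewrite row_mul -PA; apply: Pfix.
  by exists (delta_mx 0 k : 'rV[RR]_m) => //; rewrite /J /row_span_incl -rowE.
have UQ : U *m Q = 1%:M.
  by apply: (row_free_inj freeU); rewrite -mulmxA -QE UA mul1mx.
have trAS : \tr (A *m S) = kappa * m%:R.
  by rewrite QE -mulmxA US -scalemxAr mxtraceZ mxtrace_mulC UQ mxtrace1.
have colA j : \sum_i `|A i j| <= C.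
  pose x : 'rV[RR]_N := \row_i Num.sg (A i j).
  have x1 : `|x| <= 1.
    by apply: rV_norm_le => // i; rewrite mxE normr_sg lern1 leq_b1.
  have <- : (x *m A) 0 j = \sum_i `|A i j|.
    by rewrite mxE; apply: eq_bigr => i _; rewrite mxE -normrEsg.
  apply: le_trans (ler_norm _) _; apply: le_trans (rV_norm_coord _ _) _.
  by rewrite -PA; apply: le_trans (PC x) _; exact: ler_piMr.
rewrite ler_pdivrMr ?ltr0n // -trAS /mxtrace.
under eq_bigr do rewrite mxE.
rewrite exchange_big /= mulr_natr -[X in _ *+ X]card_ord -sumr_const.
apply: ler_sum => j _; apply: le_trans (colA j); apply: ler_sum => i _.
apply: le_trans (ler_norm _) _; rewrite normrM.
exact: ler_piMr.
Qed.

(** * Sign matrices of maximal equiangular systems *)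

Local Notation IZR := Rdefinitions.IZR.
Local Notation znat := BinInt.Z.of_nat.

(* Integer matrices are lists of rows, so that products compute; beware that
   [zmul A B] is the product of [A] with the transpose of [B]. *)
Definition zmx m n (A : seq (seq Z)) : 'M[RR]_(m, n) :=
  \matrix_(i, j) IZR (nth Z0 (nth [::] A i) j).

Fixpoint zdot (s t : seq Z) : Z :=
  if s is x :: s' then
    if t is y :: t' then BinInt.Z.add (BinInt.Z.mul x y) (zdot s' t') else Z0
  else Z0.

Definition zmul (A B : seq (seq Z)) : seq (seq Z) :=
  [seq [seq zdot r c | c <- B] | r <- A].

Definition zscale (k : Z) (A : seq (seq Z)) : seq (seq Z) :=
  [seq [seq BinInt.Z.mul k x | x <- r] | r <- A].

Definition zscalar (k : Z) (n : nat) : seq (seq Z) :=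
  mkseq (fun i => mkseq (fun j => if i == j then k else Z0) n) n.

Definition zshape m n (A : seq (seq Z)) : bool :=
  (size A == m) && all (fun r => size r == n) A.

Definition zbounded1 (A : seq (seq Z)) : bool :=
  all (all (fun x => BinInt.Z.leb (BinInt.Z.abs x) (Zpos xH))) A.

Lemma zdotE n (s t : seq Z) : size s = n -> size t = n ->
  IZR (zdot s t) = \sum_(k < n) IZR (nth Z0 s k) * IZR (nth Z0 t k).
Proof.
elim: n s t => [|n IHn] [|x s] [|y t] //=; first by rewrite big_ord0.
move=> [sn] [tn]; rewrite big_ord_recl /= -IHn // RIneq.plus_IZR RIneq.mult_IZR.
by [].
Qed.

Lemma zshape_row m n A i : zshape m n A -> (i < m)%N -> size (nth [::] A i) = n.
Proof.
by move=> /andP[/eqP Am /(all_nthP [::]) An] im; apply/eqP/An; rewrite Am.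
Qed.

Lemma zmx_mul m n p A B : zshape m n A -> zshape p n B ->
  zmx m n A *m (zmx p n B)^T = zmx m p (zmul A B).
Proof.
move=> sA sB; have [/eqP Am _] := andP sA; have [/eqP Bp _] := andP sB.
apply/matrixP => i j; rewrite !mxE.
rewrite (nth_map [::]) ?Am // (nth_map [::]) ?Bp //.
rewrite (@zdotE n) ?(zshape_row sA) ?(zshape_row sB) //.
by apply: eq_bigr => k _; rewrite !mxE.
Qed.

Lemma zmx_scale m n k A : zshape m n A ->
  IZR k *: zmx m n A = zmx m n (zscale k A).
Proof.
move=> sA; have [/eqP Am _] := andP sA; apply/matrixP => i j; rewrite !mxE.
by rewrite (nth_map [::]) ?Am // (nth_map Z0) ?(zshape_row sA) // RIneq.mult_IZR.
Qed.

Lemma zmx_scalar n k : zmx n n (zscalar k n) = (IZR k)%:M.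
Proof.
apply/matrixP => i j; rewrite !mxE /zscalar !nth_mkseq // -val_eqE /=.
by case: eqP.
Qed.

Lemma zmx_norm_le1 m n A :
  zbounded1 A -> forall i j, `|zmx m n A i j| <= 1.
Proof.
move=> /(all_nthP [::]) hA i j; rewrite mxE.
have : BinInt.Z.leb (BinInt.Z.abs (nth Z0 (nth [::] A i) j)) (Zpos xH).
  have [Ai|iA] := ltnP i (size A); last by rewrite (nth_default [::] iA) nth_nil.
  have /(all_nthP Z0) hr := hA _ Ai.
  have [rj|jr] := ltnP j (size (nth [::] A i)); first exact: hr.
  by rewrite nth_default.
move: (nth _ _ _) => x /BinInt.Z.leb_le x1; apply/RleP.
by rewrite -[`|_|]/(Rbasic_fun.Rabs _) Rbasic_fun.Rabs_Zabs; exact: RIneq.IZR_le.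
Qed.

Lemma IZR_of_nat k : IZR (znat k) = k%:R :> RR.
Proof. by rewrite -RIneq.INR_IZR_INZ INRE. Qed.

(** [V] certifies the rank of [U], as [V^T / d] is a right inverse. Since [zmul] transposes its
    second factor, the sign matrix applied is [S^T]. *)
Lemma max_abs_proj_const_ge_zmx m n (U V S : seq (seq Z)) (k d : nat) :
    (0 < n)%N -> (0 < d)%N ->
    [&& zshape m n U, zshape m n V, zshape n n S & zbounded1 S] ->
    zmul U V = zscalar (znat d) m -> zmul U S = zscale (znat k) U ->
  ((k%:R * m%:R / n%:R)%:E <= max_abs_proj_const m)%E.
Proof.
move=> n0 d0 /and4P[sU sV sS S1] UV US.
apply: (@max_abs_proj_const_ge n m (zmx m n U) (zmx n n S)^T) => //.
- apply/row_freeP; exists (d%:R^-1 *: (zmx m n V)^T).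
  rewrite -scalemxAr zmx_mul // UV zmx_scalar scale_scalar_mx IZR_of_nat mulVf //.
  by rewrite pnatr_eq0 -lt0n.
- by move=> i j; rewrite mxE; exact: zmx_norm_le1.
- by rewrite zmx_mul // US -zmx_scale // IZR_of_nat.
Qed.

Definition zsign (b : bool) : Z := if b then Zneg xH else Zpos xH.

(** Twice the identity minus the all-ones matrix: its eigenvalue is [2] on the vectors of sum
    zero. *)
Definition simplex_S :=
  [seq [seq zsign (i != j) | j <- iota 0 3] | i <- iota 0 3].

Definition simplex_U :=
  [seq [seq if j == 2 then zsign true else znat (i == j) | j <- iota 0 3]
  | i <- iota 0 2].

Definition simplex_V := [seq [seq znat (i == j) | j <- iota 0 3] | i <- iota 0 2].

Lemma max_abs_proj_const2_ge : ((4 / 3 : RR)%:E <= max_abs_proj_const 2)%E.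
Proof.
have := @max_abs_proj_const_ge_zmx 2 3 simplex_U simplex_V simplex_S 2 1 isT isT
  isT erefl erefl.
by apply: le_trans; rewrite lee_fin; lra.
Qed.

(* Sets of points are encoded as bit masks. *)
Fixpoint popcount_pos (p : positive) : nat :=
  match p with
  | xH => 1
  | xO p => popcount_pos p
  | xI p => (popcount_pos p).+1
  end.

Definition popcount (a : N) : nat := if a is Npos p then popcount_pos p else 0.

Definition meets (a b : N) : bool := ~~ BinNat.N.eqb (BinNat.N.land a b) N0.

Definition doublings (g : N) n : seq N := traject BinNat.N.double g n.

Definition points n : seq N := doublings (Npos xH) n.

(* The 28 lines are indexed by the edges of the complete graph [K_8]; the signs
   have an eigenspace made of the functions [{a, b} |-> g a + g b] with
   [sum g = 0], and the mask [128] is the eighth point. *)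
Definition edges8 : seq N :=
  [seq w <- [seq BinNat.N.of_nat i | i <- iota 0 256] | popcount w == 2].

Definition eighth : N := BinNat.N.of_nat 128.

Definition edges8_S :=
  [seq [seq zsign (~~ meets a b) | b <- edges8] | a <- edges8].

Definition edges8_U :=
  [seq [seq BinInt.Z.sub (znat (meets p a)) (znat (meets eighth a)) | a <- edges8]
  | p <- points 7].

(** On the edges through the eighth point, row [p] of [edges8_U] is [0] at the edge to [p] and [-1]
    elsewhere. Weights [5] and [-1], of sum [-1], therefore give [6] for equal points and [0]
    otherwise. *)
Definition edges8_V :=
  [seq [seq if meets eighth a
            then if meets p a then znat 5 else BinInt.Z.opp (znat 1)
            else znat 0
       | a <- edges8] | p <- points 7].

Lemma edges8_shapes :
  [&& zshape 7 28 edges8_U, zshape 7 28 edges8_V, zshape 28 28 edges8_S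
    & zbounded1 edges8_S].
Proof. by vm_compute. Qed.

Lemma edges8_UV : zmul edges8_U edges8_V = zscalar (znat 6) 7.
Proof. by vm_compute. Qed.

(** For [g] of sum zero the edges meeting [{a, b}] contribute [5 (g a + g b)]. The sum over all
    edges is zero, so the disjoint ones, counted negatively, contribute as much again. *)
Lemma edges8_US : zmul edges8_U edges8_S = zscale (znat 10) edges8_U.
Proof. by vm_compute. Qed.

Lemma max_abs_proj_const7_ge : ((5 / 2 : RR)%:E <= max_abs_proj_const 7)%E.
Proof.
have := @max_abs_proj_const_ge_zmx 7 28 edges8_U edges8_V edges8_S 10 6 isT isT
  edges8_shapes edges8_UV edges8_US.
by apply: le_trans; rewrite lee_fin; lra.
Qed.

(* The 276 lines are indexed by the points and the blocks of the Steiner system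
   [S(4, 7, 23)], whose blocks are the words of weight 7 of the binary Golay code;
   [2787] encodes its generator polynomial
   [x^11 + x^9 + x^7 + x^6 + x^5 + x + 1]. *)
Definition xor_span (gens : seq N) : seq N :=
  foldr (fun g ws => ws ++ map (BinNat.N.lxor g) ws) [:: N0] gens.

Definition witt_blocks : seq N :=
  [seq w <- xor_span (doublings (BinNat.N.of_nat 2787) 12) | popcount w == 7].

Definition witt_verts : seq N := points 23 ++ witt_blocks.

(* The sign is negative for a point outside a block and for two blocks with a
   single common point: the threshold is 0 for two points, 1 for a point and a
   block, and 2 for two blocks. *)
Definition witt_S :=
  [seq [seq zsign (popcount (BinNat.N.land a b)
                   < (popcount a + popcount b) %/ 7)%N
       | b <- witt_verts] | a <- witt_verts].

(* Each point lies in 77 blocks and two points lie in 21, so the eigenvalue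
   equation at the points leaves only the values 6, 2 and -1, up to a factor. *)
Definition witt_U :=
  [seq [seq if popcount a == 1 then if BinNat.N.eqb a p then znat 6 else znat 0
            else if meets a p then znat 2 else BinInt.Z.opp (znat 1)
       | a <- witt_verts] | p <- points 23].

Definition witt_V :=
  [seq [seq znat (BinNat.N.eqb a p) | a <- witt_verts] | p <- points 23].

Lemma witt_shapes :
  [&& zshape 23 276 witt_U, zshape 23 276 witt_V, zshape 276 276 witt_S
    & zbounded1 witt_S].
Proof. by vm_compute. Qed.

Lemma witt_UV : zmul witt_U witt_V = zscalar (znat 6) 23.
Proof. by vm_compute. Qed.

(** At the point [p] of its row, the equation reads [6 + 77 * 2 + 176 = 56 * 6], with 176 blocks
    missing [p]. *)
Lemma witt_US : zmul witt_U witt_S = zscale (znat 56) witt_U.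
Proof. by vm_compute. Qed.

Lemma max_abs_proj_const23_ge : ((14 / 3 : RR)%:E <= max_abs_proj_const 23)%E.
Proof.
have := @max_abs_proj_const_ge_zmx 23 276 witt_U witt_V witt_S 56 6 isT isT
  witt_shapes witt_UV witt_US.
by apply: le_trans; rewrite lee_fin; lra.
Qed.

(* The identity plus the Paley conference matrix of order 6. *)
Definition paley_S :=
  [seq [seq zsign b | b <- r] | r <-
    [:: [:: false; false; false; false; false; false];
        [:: false; false; false; true; true; false];
        [:: false; false; false; false; true; true];
        [:: false; true; false; false; false; true];
        [:: false; true; true; false; false; false];
        [:: false; false; true; true; false; false]]].

Definition paley_R := [seq [seq znat (i == j) | j <- iota 0 6] | i <- iota 0 3].

(** The eigenvalue is irrational, so only the identities for [S] are computed over the integers; the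
    eigenspace is reached through the polynomial [S + (kappa - 2)], of which three rows are kept. *)
Lemma max_abs_proj_const3_ge :
  (((1 + Num.sqrt 5) / 2 : RR)%:E <= max_abs_proj_const 3)%E.
Proof.
pose S := zmx 6 6 paley_S; pose P := zmx 3 6 paley_R.
pose J := zmx 3 3 (nseq 3 (nseq 3 (znat 1))).
pose kappa : RR := 1 + Num.sqrt 5.
have s5 : Num.sqrt 5 ^+ 2 = 5 :> RR by rewrite sqr_sqrtr.
have s0 : 0 <= Num.sqrt 5 :> RR by exact: sqrtr_ge0.
have ST : S^T = S.
  by apply/matrixP => i j; rewrite !mxE; congr IZR;
    move: i j => [[|[|[|[|[|[|//]]]]]] ?] [[|[|[|[|[|[|//]]]]]] ?].
have SS : S *m S = 2 *: S + 4%:M.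
  rewrite -{2}ST zmx_mul // -(IZR_of_nat 2) -(IZR_of_nat 4) zmx_scale //.
  rewrite -zmx_scalar; apply/matrixP => i j; rewrite !mxE.
  rewrite -[RHS]RIneq.plus_IZR; congr IZR.
  by move: i j => [[|[|[|[|[|[|//]]]]]] ?] [[|[|[|[|[|[|//]]]]]] ?].
have PSP : P *m S *m P^T = J by rewrite -ST !zmx_mul.
have PP : P *m P^T = 1%:M by rewrite zmx_mul // -(zmx_scalar 3 (znat 1)).
have JJ : J *m J = 3 *: J.
  have JT : J^T = J.
    by apply/matrixP => i j; rewrite !mxE; congr IZR;
      move: i j => [[|[|[|//]]] ?] [[|[|[|//]]] ?].
  by rewrite -{2}JT zmx_mul // -(IZR_of_nat 3) zmx_scale.
(* [(S + (kappa - 2)) (S - kappa) = 0], since [kappa^2 = 2 kappa + 4]. *)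
pose U := P *m (S + (kappa - 2)%:M).
have US : U *m S = kappa *: U.
  rewrite /U -mulmxA scalemxAr; congr (_ *m _).
  rewrite mulmxDl SS mul_scalar_mx addrAC -scalerDl scalerDr scale_scalar_mx.
  congr (_ *: _ + _%:M); rewrite /kappa; nra.
have Ufree : row_free U.
  (* The leading block of [S] is the all-ones matrix [J], so [U P^T = J + (kappa - 2)]; its inverse
     [(kappa + 1 - J) / (kappa + 2)] follows from [J ^ 2 = 3 J]. *)
  apply/row_freeP; exists ((kappa + 2)^-1 *: (P^T *m ((kappa + 1)%:M - J))).
  have UP : U *m P^T = J + (kappa - 2)%:M.
    rewrite /U mulmxDr mulmxDl PSP mul_mx_scalar -scalemxAl PP.
    by rewrite scale_scalar_mx mulr1.
  rewrite -scalemxAr mulmxA UP mulmxBr !mulmxDl !mul_mx_scalar !mul_scalar_mx.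
  rewrite JJ scale_scalar_mx.
  have -> : (kappa + 1) *: J + ((kappa + 1) * (kappa - 2))%:M
            - (3 *: J + (kappa - 2) *: J) = (kappa + 2)%:M.
    rewrite addrAC -!scalerDl -scalerBl.
    rewrite (_ : _ - _ = 0) ?scale0r ?add0r; last by ring.
    by congr (_%:M); rewrite /kappa; nra.
  by rewrite scale_scalar_mx mulVf // gt_eqF // /kappa; lra.
have S1 i j : `|S i j| <= 1 by exact: zmx_norm_le1.
have := @max_abs_proj_const_ge 6 3 U S kappa isT Ufree S1 US.
by apply: le_trans; rewrite lee_fin /kappa; lra.
Qed.

(** * Agreement of the upper and lower bounds *)

Lemma max_abs_proj_const_le m (q : RR) :
    (1 < m)%N -> 0 <= q -> q ^+ 2 = m%:R + 2 ->
  (max_abs_proj_const m <= ((q - 1) * (q + 2) / (q + 1))%:E)%E.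
Proof.
move=> m1 q0 q2; apply: ge_ereal_sup => _ [Y [e [eY ->]]].
apply: ge_ereal_sup => _ [X [J [isoJ ->]]].
exact: (rel_proj_const_le m1 q0 q2 eY isoJ).
Qed.

Theorem theorem6 :
  [/\ max_abs_proj_const 2 = ((4 / 3 : RR)%:E)%E,
      max_abs_proj_const 3 = (((1 + Num.sqrt 5) / 2 : RR)%:E)%E,
      max_abs_proj_const 7 = ((5 / 2 : RR)%:E)%E
    & max_abs_proj_const 23 = ((14 / 3 : RR)%:E)%E].
Proof.
have s0 : 0 <= Num.sqrt 5 :> RR by exact: sqrtr_ge0.
have s5 : Num.sqrt 5 ^+ 2 = 5 :> RR by rewrite sqr_sqrtr.
split; apply/eqP; rewrite eq_le.
- rewrite max_abs_proj_const2_ge andbT.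
  have q2 : 2 ^+ 2 = 2%:R + 2 :> RR by ring.
  apply: le_trans (@max_abs_proj_const_le 2 2 isT _ q2) _; first by [].
  by rewrite lee_fin ler_pdivrMr; lra.
- rewrite max_abs_proj_const3_ge andbT.
  have q2 : Num.sqrt 5 ^+ 2 = 3%:R + 2 :> RR by rewrite s5; ring.
  apply: le_trans (@max_abs_proj_const_le 3 (Num.sqrt 5) isT s0 q2) _.
  (* Both sides reduce to [3 + sqrt 5 = (1 + sqrt 5) ^ 2 / 2]. *)
  by rewrite lee_fin ler_pdivrMr; [nra|lra].
- rewrite max_abs_proj_const7_ge andbT.
  have q2 : 3 ^+ 2 = 7%:R + 2 :> RR by ring.
  apply: le_trans (@max_abs_proj_const_le 7 3 isT _ q2) _; first by [].
  by rewrite lee_fin ler_pdivrMr; lra.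
- rewrite max_abs_proj_const23_ge andbT.
  have q2 : 5 ^+ 2 = 23%:R + 2 :> RR by ring.
  apply: le_trans (@max_abs_proj_const_le 23 5 isT _ q2) _; first by [].
  by rewrite lee_fin ler_pdivrMr; lra.
Qed.
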